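(* Let $n>0$ be an integer. Then \[ \sum_{0\le 3j\le n}\frac{(-1)^j(q^3;q^3)_{n-j-1}(1-q^{2n})\,q^{3j^2-3j}}{(q;q)_{n-3j}\,(q^6;q^6)_{j}} \;=\; \sum_{j=-\infty}^{\infty}(-1)^j q^{3j^2+3j}{2n\brack n-3j}_q . \]
   Context: For a non-negative integer $L$, $(a;q)_L=\prod_{k=0}^{L-1}(1-aq^k)$. For integers $m,n$, the $q$-binomial coefficient is ${m+n\brack n}_q=\frac{(q;q)_{m+n}}{(q;q)_m(q;q)_n}$ if $m,n\ge 0$ and $0$ otherwise. *)

(* Defs.v *)
From mathcomp Require Import all_boot all_order all_algebra.
From mathcomp Require Import classical_sets fsbigop.

Set Implicit Arguments.
Unset Strict Implicit.
Unset Printing Implicit Defensive.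

Import GRing.Theory.
Local Open Scope ring_scope.

Definition qpoch (F : fieldType) (a q : F) (L : nat) : F :=
  \prod_(k < L) (1 - a * q ^+ k).

(* [a brack b]_q, i.e. [m + n brack n]_q with n = b and m = a - b. In the first
   branch a, b and a - b are all nonnegative, so absz is the identity there. *)
Definition qbinom (F : fieldType) (q : F) (a b : int) : F :=
  if (0 <= a - b) && (0 <= b) then
    qpoch q q `|a|%N / (qpoch q q `|(a - b)%R|%N * qpoch q q `|b|%N)
  else 0.

(* Main.v *)
Require Import Defs.
From mathcomp Require Import all_boot all_order all_algebra.
From mathcomp Require Import classical_sets fsbigop.
From mathcomp Require Import zify ring.

Import GRing.Theory.
Local Open Scope ring_scope.

(** Write Q = q^3. Each binomial on the right is expanded by the cubic summation
    [2n, n-3j]_q = (1-q^(2n)) sum_r Q^(r^2-j^2) (Q;Q)_(n-r-1)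
                   / ((q;q)_(n-3r) (Q;Q)_(r-j) (Q;Q)_(r+j)),
    a form of the q-Pfaff-Saalschuetz sum that reduces to a smaller instance by
    creative telescoping in j. After exchanging the sums, the sum over |j| <= r is
    the Gauss-type sum over k = r + j of (-Q)^k / ((Q;Q)_k (Q;Q)_(2r-k)), whose
    value is 1/(Q^2;Q^2)_r. No power of q is ever divided out, so q = 0
    needs no separate treatment. *)

(** * Shifted factorials at a base that is not a root of unity *)

Lemma qpoch0 (F : fieldType) (a q : F) : qpoch a q 0 = 1.
Proof. by rewrite /qpoch big_ord0. Qed.

Lemma qpochS (F : fieldType) (q : F) (L : nat) :
  qpoch q q L.+1 = qpoch q q L * (1 - q ^+ L.+1).
Proof. by rewrite /qpoch big_ord_recr /= -exprS. Qed.

Definition not_root_of_unity (F : fieldType) (q : F) : Prop :=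
  forall k : nat, (0 < k)%N -> q ^+ k != 1.

Lemma not_root_of_unityX (F : fieldType) (q : F) (d : nat) :
  not_root_of_unity F q -> (0 < d)%N -> not_root_of_unity F (q ^+ d).
Proof. by move=> hq d0 k k0; rewrite -exprM hq // muln_gt0 d0. Qed.

Lemma subr1X_neq0 (F : fieldType) (q : F) (k : nat) :
  not_root_of_unity F q -> (0 < k)%N -> 1 - q ^+ k != 0.
Proof. by move=> hq k0; rewrite subr_eq0 eq_sym hq. Qed.

Lemma qpoch_neq0 (F : fieldType) (q : F) (L : nat) :
  not_root_of_unity F q -> qpoch q q L != 0.
Proof.
move=> hq; elim: L => [|L IHL]; first by rewrite qpoch0 oner_neq0.
by rewrite qpochS mulf_neq0 // subr1X_neq0.
Qed.

(** Reading 1/(q;q)_(m-3) as 0 for m < 3 agrees with the product on the right, which has a zero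
    factor for m = 0, 1, 2. The factor [q ^+ 3] stays on the left so that [q = 0] is allowed. *)
Lemma qpoch_drop3 (F : fieldType) (q : F) (m : nat) : not_root_of_unity F q ->
  (if (3 <= m)%N then (qpoch q q (m - 3))^-1 else 0) * q ^+ 3
  = (1 - q ^+ m) * (q - q ^+ m) * (q ^+ 2 - q ^+ m) / qpoch q q m.
Proof.
move=> hq; case: m => [|[|[|m]]] /=; rewrite ?subrr ?mulr0 ?mul0r //.
rewrite !subSS subn0 !qpochS.
have h0 := qpoch_neq0 F q m hq.
have h1 := subr1X_neq0 F q m.+1 hq isT.
have h2 := subr1X_neq0 F q m.+2 hq isT.
have h3 := subr1X_neq0 F q m.+3 hq isT.
move: h1 h2 h3; rewrite !exprS => h1 h2 h3.
field.
by rewrite h0 h1 h2 h3.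
Qed.

(** * The cubic summation *)

Section Cubic.
Variables (F : fieldType) (q : F).
Hypothesis hq : not_root_of_unity F q.
Let Q := q ^+ 3.
Let p := qpoch q q.
Let P := qpoch Q Q.

Let hQ : not_root_of_unity F Q.
Proof. exact: not_root_of_unityX. Qed.

(* [H] is a Wilf-Zeilberger certificate; the step lowers [M] by 3 while raising [a]
   by 2, i.e. it passes from j to j + 1 when [a = 2 j]. *)
Lemma cubic_summand_telescopes a m s :
  let M := (m + 3 * s)%N in
  let H t : F := if (3 * t <= M)%N then
    (1 - Q ^+ a.+1) * Q ^+ (t ^ 2 + t * a + 2 * t) * P (a + M + 2 - t)%N
    / (p (M - 3 * t)%N * P t * P (t + 1 + a)%N) else 0 in
  (1 - q ^+ M.+1) * (1 - q ^+ M.+2) * (1 - q ^+ M.+3) *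
  (Q ^+ (s.+1 ^ 2 + s.+1 * a) * P (a + M.+3 - s.+1 - 1)%N
     / (p (M.+3 - 3 * s.+1)%N * P s.+1 * P (s.+1 + a)%N))
  - (1 - q ^+ (3 * a + M).+4) * (1 - q ^+ (3 * a + M).+4.+1)
     * (1 - q ^+ (3 * a + M).+4.+2) *
  (Q ^+ (s ^ 2 + s * a.+2) * P (a.+2 + M - s - 1)%N
     / (p (M - 3 * s)%N * P s * P (s + a.+2)%N))
  = H s.+1 - H s.
Proof.
move=> M H; rewrite {}/H.
have -> : (3 * s.+1 <= M)%N = (3 <= m)%N by rewrite /M; lia.
have -> : (3 * s <= M)%N by rewrite /M; lia.
have -> : (M - 3 * s.+1 = m - 3)%N by rewrite /M; lia.
have -> : (M - 3 * s = m)%N by rewrite /M; lia.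
have -> : (M.+3 - 3 * s.+1 = m)%N by rewrite /M; lia.
have -> : (a + M.+3 - s.+1 - 1 = (a + m + 2 * s).+1)%N by rewrite /M; lia.
have -> : (a.+2 + M - s - 1 = (a + m + 2 * s).+1)%N by rewrite /M; lia.
have -> : (a + M + 2 - s.+1 = (a + m + 2 * s).+1)%N by rewrite /M; lia.
have -> : (a + M + 2 - s = (a + m + 2 * s).+2)%N by rewrite /M; lia.
have -> : (s ^ 2 + s * a.+2 = s ^ 2 + s * a + 2 * s)%N by lia.
have -> : (s.+1 ^ 2 + s.+1 * a + 2 * s.+1
           = (s ^ 2 + s * a + 2 * s) + a + s + s + 3)%N by lia.
have -> : (s.+1 ^ 2 + s.+1 * a = ((s ^ 2 + s * a + 2 * s) + a).+1)%N by lia.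
have -> : (s + a.+2 = (s + a).+2)%N by lia.
have -> : (s.+1 + 1 + a = (s + a).+2)%N by lia.
have -> : (s.+1 + a = (s + a).+1)%N by lia.
have -> : (s + 1 + a = (s + a).+1)%N by lia.
have -> : forall c d e : F, (if (3 <= m)%N then c / (p (m - 3)%N * d * e) else 0)
  = c / (d * e) * (if (3 <= m)%N then (p (m - 3)%N)^-1 else 0).
  by move=> c d e; case: ifP; rewrite ?mulr0 // !invfM => _; ring.
have hm := qpoch_drop3 F q m hq; rewrite -/p -/Q in hm.
set e := (if _ then _ else _) in hm *.
have pm0 : p m != 0 by exact: qpoch_neq0.
have Ps0 : P s != 0 by exact: qpoch_neq0.
have Psa0 : P (s + a)%N != 0 by exact: qpoch_neq0.
have h1 := subr1X_neq0 F Q s.+1 hQ isT.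
have h2 := subr1X_neq0 F Q (s + a).+1 hQ isT.
have h3 := subr1X_neq0 F Q (s + a).+2 hQ isT.
have qM : q ^+ M = q ^+ m * Q ^+ s by rewrite /M exprD exprM.
have qaM : q ^+ (3 * a + M) = Q ^+ a * (q ^+ m * Q ^+ s) by rewrite exprD exprM qM.
have QN : Q ^+ (a + m + 2 * s)%N = Q ^+ a * (q ^+ m) ^+ 3 * (Q ^+ s) ^+ 2.
  by rewrite (exprD Q (a + m)) (exprD Q a) (exprAC q m) (mulnC 2%N s) (exprM Q s).
have PS L : P L.+1 = P L * (1 - Q ^+ L.+1) by exact: qpochS.
move: h1 h2 h3; rewrite (PS (a + m + 2 * s).+1) (PS (s + a).+1) (PS (s + a)%N) (PS s).
rewrite !(exprS Q (_.+1)) !(exprS Q (_ + _)%N) !(exprS Q s) !(exprS Q a) !(exprS q).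
rewrite QN qM qaM (exprD Q s a).
rewrite (exprD Q _ 3) !(exprD Q _ s) !(exprD Q _ a).
set X := Q ^+ (s ^ 2 + s * a + 2 * s).
(* [Q ^+ 3] gives up one factor [Q], the [q ^+ 3] that [qpoch_drop3] asks for; nothing is divided by
   [q]. *)
have -> : forall b c d f : F,
  b * (c * Q ^+ 3) * d / f * e = b * (c * Q ^+ 2) * d / f * (e * Q).
  by move=> b c d f; ring.
rewrite hm => h1 h2 h3.
rewrite /Q in h1 h2 h3 *.
field.
by rewrite h1 h2 h3 pm0 Ps0 Psa0.
Qed.

(* The upper bound [B] is immaterial; it serves as the induction variable. *)
Lemma cubic_sum B a M : (0 < a + M)%N -> (M < 3 * B)%N ->
  \sum_(s < B | (3 * s <= M)%N)
    (Q ^+ (s ^ 2 + s * a) * P (a + M - s - 1)%N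
     / (p (M - 3 * s)%N * P s * P (s + a)%N))
  = p (3 * a + 2 * M - 1)%N / (p M * p (3 * a + M)%N).
Proof.
have P0 : P 0 = 1 by exact: qpoch0.
have p0 : p 0 = 1 by exact: qpoch0.
have nzp L : p L != 0 by exact: qpoch_neq0.
have nzP L : P L != 0 by exact: qpoch_neq0.
have nz1 L : 1 - q ^+ L.+1 != 0 by exact: subr1X_neq0.
have pS L : p L.+1 = p L * (1 - q ^+ L.+1) by exact: qpochS.
have PS L : P L.+1 = P L * (1 - Q ^+ L.+1) by exact: qpochS.
elim: B a M => [|B IHB] a M aM MB; first by lia.
rewrite big_mkcond big_ord_recl -big_mkcond /=.
rewrite ?muln0 ?subn0 ?mul0n ?add0n ?addn0 ?expr0 ?mul1r ?P0 ?mulr1.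
(* For [M < 3] only [s = 0] contributes. When [M = 0] the hypothesis forces [a > 0], so [a - 1] is a
   true subtraction. *)
have [M3|M3] := ltnP M 3.
  rewrite big_pred0 ?addr0; last by move=> i; rewrite /bump; lia.
  case: M M3 {MB} aM => [|[|[|//]]] _ aM.
  - case: a aM => [|a]; first by lia.
    rewrite !addn0 subn1 p0 !mul1r /= (PS a).
    have -> : (3 * a.+1 - 1 = (3 * a).+2)%N by lia.
    have -> : (3 * a.+1 = (3 * a).+3)%N by lia.
    rewrite (pS (3 * a).+2) /Q -exprM.
    have -> : (3 * a.+1 = (3 * a).+3)%N by lia.
    have := nz1 (3 * a).+2; have := nzp (3 * a).+2; have := nzP a.
    by move=> *; field; apply/and3P.
  - rewrite addn1 subn1 /= addn1.
    have -> : (3 * a + 2 * 1 - 1 = (3 * a).+1)%N by lia.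
    have := nzp 1%N; have := nzp (3 * a).+1; have := nzP a.
    by move=> *; field; apply/and3P.
  - rewrite addn2 subn1 /= addn2.
    have -> : (3 * a + 2 * 2 - 1 = (3 * a).+3)%N by lia.
    rewrite (PS a) (pS (3 * a).+2) /Q -exprM.
    have -> : (3 * a.+1 = (3 * a).+3)%N by lia.
    have := nzp 2%N; have := nzp (3 * a).+2; have := nzP a.
    by move=> *; field; apply/and3P.
case: M M3 MB aM => [|[|[|M]]] // _ MB aM.
(* The smaller instance has the same numerator, as 3(a + 2) + 2M = 3a + 2(M + 3); only the
   denominators differ, by three factors each. *)
have := IHB a.+2 M ltac:(lia) ltac:(lia).
set S := \sum_(s < B | _) _ => hS; set S' := \sum_(s < B | _) _.
pose H t : F := if (3 * t <= M)%N then
    (1 - Q ^+ a.+1) * Q ^+ (t ^ 2 + t * a + 2 * t) * P (a + M + 2 - t)%N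
    / (p (M - 3 * t)%N * P t * P (t + 1 + a)%N) else 0.
(* [H B] vanishes because [3 * B] exceeds [M]; [- H 0] will cancel the split-off term [s = 0] once
   that is multiplied by the three factors in front of [S']. *)
have hH : (1 - q ^+ M.+1) * (1 - q ^+ M.+2) * (1 - q ^+ M.+3) * S'
  - (1 - q ^+ (3 * a + M).+4) * (1 - q ^+ (3 * a + M).+4.+1)
     * (1 - q ^+ (3 * a + M).+4.+2) * S = - H 0.
  transitivity (H B - H 0); last by rewrite {1}/H ifN ?sub0r //; lia.
  rewrite -telescope_sumr // big_mkord /S /S' !mulr_sumr.
  rewrite (eq_bigl (fun s : 'I_B => (3 * s <= M)%N)); last first.
    by move=> s; rewrite /bump; lia.
  rewrite -sumrB big_mkcond; apply: eq_bigr => s _.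
  case: ifPn => sM; last by rewrite /H !ifN ?subrr //; lia.
  by have := cubic_summand_telescopes a (M - 3 * s) s; rewrite subnK // /bump add1n.
have hH0 : H 0%N = P (a + M.+3 - 1)%N / (p M * P a).
  rewrite /H muln0 !subn0 (_ : 0 ^ 2 + 0 * a + 2 * 0 = 0)%N //= expr0 mulr1 P0 mulr1.
  have -> : (a + M.+3 - 1 = a + M + 2)%N by lia.
  rewrite add0n add1n PS.
  have := subr1X_neq0 F Q a.+1 hQ isT; have := nzP a; have := nzp M.
  by move=> *; field; apply/and3P.
move: hH; rewrite hS hH0.
have -> : (3 * a.+2 + 2 * M - 1 = 3 * a + 2 * M.+3 - 1)%N by lia.
have -> : (3 * a.+2 + M = (3 * a + M).+4.+2)%N by lia.
have -> : (3 * a + M.+3 = (3 * a + M).+3)%N by lia.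
rewrite (pS (3 * a + M).+4.+1) (pS (3 * a + M).+4) (pS (3 * a + M).+3).
rewrite (pS M.+2) (pS M.+1) (pS M).
have := nz1 (3 * a + M).+4.+1; have := nz1 (3 * a + M).+4; have := nz1 (3 * a + M).+3.
have := nz1 M.+2; have := nz1 M.+1; have := nz1 M.
have := nzp (3 * a + M).+3; have := nzp M; have := nzP a.
move: (p (3 * a + M).+3) (P a) (p M) (P _) (p _) S'.
move: (1 - q ^+ M.+1) (1 - q ^+ M.+2) (1 - q ^+ M.+3).
move: (1 - q ^+ (3 * a + M).+4) (1 - q ^+ (3 * a + M).+4.+1) (1 - q ^+ (3 * a + M).+4.+2).
move=> u1 u2 u3 f1 f2 f3 b c d e g S' c0 d0 b0 f10 f20 f30 u10 u20 u30 /eqP.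
rewrite subr_eq => /eqP hS'.
have -> : S' = (f1 * f2 * f3 * S') / (f1 * f2 * f3) by field; apply/and3P.
rewrite hS'; field.
by rewrite c0 d0 b0 f10 f20 f30 u10 u20 u30.
Qed.
End Cubic.

(** * The Gauss-type alternating sum *)

Section Gauss.
Variables (F : fieldType) (q : F).
Hypothesis hq : not_root_of_unity F q.
Let p := qpoch q q.

(* Stands for the functional equation F(qx) = (1 - x) F(x) of F = sum x^k/(q;q)_k. *)
Lemma conv_qpochV_shift (g : nat -> F) m :
  \sum_(k < m.+2) (1 - q ^+ (m.+1 - k)) / p (m.+1 - k)%N * g k
  = \sum_(k < m.+1) (p (m - k)%N)^-1 * g k.
Proof.
rewrite big_ord_recr /= subnn expr0 subrr !mul0r addr0.
apply: eq_bigr => k _; congr (_ * _).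
rewrite subSn; last by rewrite -ltnS.
have := qpoch_neq0 F q (m - k) hq; have := subr1X_neq0 F q (m - k).+1 hq isT.
by rewrite /p qpochS => *; field; apply/andP.
Qed.

(** The coefficient of x^m in F(x) F(-qx), that is, the Rogers-Szego polynomial at -q divided by
    (q;q)_m. *)
Definition gauss_sum m : F := \sum_(k < m.+1) (p (m - k)%N)^-1 * ((- q) ^+ k / p k).

(** G(x) = F(x) F(-qx) satisfies G(qx) = (1 - x)(1 + qx) G(x); compare coefficients of x^(m+2). *)
Lemma gauss_sum_rec m :
  (1 - q ^+ m.+2) * gauss_sum m.+2 = (1 - q) * gauss_sum m.+1 + q * gauss_sum m.
Proof.
pose g k := (- q) ^+ k / p k.
(* Uses 1 - q^(m+2) = (1 - q^(m+2-k)) + q^(m+2-k) (1 - q^k), one piece for each factor F. *)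
have -> : (1 - q ^+ m.+2) * gauss_sum m.+2 =
    \sum_(k < m.+3) (1 - q ^+ (m.+2 - k)) / p (m.+2 - k)%N * g k
  + \sum_(k < m.+3) q ^+ (m.+2 - k) / p (m.+2 - k)%N * ((1 - q ^+ k) * g k).
  rewrite /gauss_sum mulr_sumr -big_split; apply: eq_bigr => k _ /=.
  have -> : q ^+ m.+2 = q ^+ (m.+2 - k) * q ^+ k by rewrite -exprD subnK // -ltnS.
  by rewrite -/(g k); ring.
rewrite conv_qpochV_shift [X in _ + X]big_ord_recl /= expr0 subrr mul0r mulr0 add0r.
(* Here [(1 - q ^+ k.+1) * g k.+1 = - q * g k], and the power q^(m+1-k) is written as 1 - (1 -
   q^(m+1-k)). *)
rewrite [X in _ + X](eq_bigr (fun k : 'I_m.+2 => - q * ((p (m.+1 - k)%N)^-1 * g k)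
    + q * ((1 - q ^+ (m.+1 - k)) / p (m.+1 - k)%N * g k))); last first.
  move=> k _; rewrite /bump add1n subSS /g.
  have := qpoch_neq0 F q k hq; have := subr1X_neq0 F q k.+1 hq isT.
  have := qpoch_neq0 F q (m.+1 - k) hq.
  by rewrite /p (qpochS _ _ k) !exprS => *; field; apply/and3P.
rewrite big_split /= -!mulr_sumr conv_qpochV_shift /gauss_sum.
by ring.
Qed.

(** F(x) F(-qx) = (1 + x)/(x^2;q^2)_inf, so coefficients come in equal pairs. The odd ones are
    carried along because the recurrence has order two. *)
Lemma gauss_sumE r :
  gauss_sum (2 * r) = (qpoch (q ^+ 2) (q ^+ 2) r)^-1 /\
  gauss_sum (2 * r).+1 = (qpoch (q ^+ 2) (q ^+ 2) r)^-1.
Proof.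
have hq1 k := subr1X_neq0 F q k.+1 hq isT.
elim: r => [|r [IH0 IH1]].
  rewrite muln0 /gauss_sum !big_ord_recr !big_ord0 /= /p !qpochS !qpoch0.
  split; first by rewrite expr0 divr1 invr1 mulr1 add0r.
  by have := hq1 0%N; rewrite !expr1 expr0 => h; rewrite invr1 add0r !mul1r; field.
have E : gauss_sum (2 * r).+2 = (qpoch (q ^+ 2) (q ^+ 2) r.+1)^-1.
  apply: (mulfI (hq1 (2 * r).+1)); rewrite gauss_sum_rec IH0 IH1 qpochS -exprM.
  have -> : (2 * r.+1 = (2 * r).+2)%N by lia.
  have := hq1 (2 * r).+1.
  have := qpoch_neq0 F (q ^+ 2) r (not_root_of_unityX F q 2 hq isT).
  by move=> *; field; apply/andP.
have -> : (2 * r.+1 = (2 * r).+2)%N by lia.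
split=> //; apply: (mulfI (hq1 (2 * r).+2)); rewrite gauss_sum_rec E IH1 qpochS -exprM.
have -> : (2 * r.+1 = (2 * r).+2)%N by lia.
have := hq1 (2 * r).+1.
have := qpoch_neq0 F (q ^+ 2) r (not_root_of_unityX F q 2 hq isT).
by rewrite !exprS => *; field; apply/andP.
Qed.
End Gauss.

(** Passes from the index i = j + n, common to all r, to the index k = j + r of the Gauss sum. *)
Lemma big_absz_le (F : fieldType) (n r : nat) (G : int -> F) : (r <= n)%N ->
  \sum_(i < (2 * n).+1 | (`|(i : int) - n%:Z|%N <= r)%N) G (i%:Z - n%:Z)
  = \sum_(k < (2 * r).+1) G (k%:Z - r%:Z).
Proof.
move=> rn.
rewrite -(big_mkord (fun i => `|i%:Z - n%:Z|%N <= r)%N (fun i => G (i%:Z - n%:Z))).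
rewrite (eq_bigl (fun i => (n - r <= i) && (i < n + r.+1))%N); last first.
  by move=> i; lia.
rewrite -(big_nat_widen 0 _ _ (fun i => n - r <= i)%N); last by lia.
rewrite -(big_nat_widenl (n - r) 0 _ predT) //.
rewrite -[(n - r)%N]add0n big_addn -(big_mkord predT (fun k => G (k%:Z - r%:Z))).
have -> : (n + r.+1 - (n - r) = (2 * r).+1)%N by lia.
by apply: eq_bigr => i _; congr G; lia.
Qed.

(** * Expansion of the binomials and evaluation of the inner sum *)

Section Main.
Variables (F : fieldType) (q : F).
Hypothesis hq : not_root_of_unity F q.
Let Q := q ^+ 3.
Let p := qpoch q q.
Let P := qpoch Q Q.

(** This is [cubic_sum] at a = 2|j|, M = n - 3|j|, with s = r - |j| and s^2 + 2s|j| = r^2 - j^2.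
    Only |j| matters, since (q;q)_(n-3j) (q;q)_(n+3j) is even in j. *)
Lemma qbinom_cubic (n : nat) (j : int) : (0 < n)%N ->
  qbinom q (2 * n%:Z) (n%:Z - 3 * j) =
  (1 - q ^+ (2 * n)) * \sum_(r < n.+1 | (3 * r <= n)%N && (`|j|%N <= r)%N)
    (Q ^+ (r ^ 2 - `|j|%N ^ 2) * P (n - r - 1)%N
      / (p (n - 3 * r)%N * P (r - `|j|%N)%N * P (r + `|j|%N)%N)).
Proof.
move=> n0; rewrite /qbinom; case: ifPn => hj; last first.
  by rewrite big_pred0 ?mulr0 // => r; lia.
have jn : (3 * `|j|%N <= n)%N by lia.
have -> : `|(2 * n%:Z)%R|%N = (2 * n)%N by lia.
have -> : qpoch q q `|(2 * n%:Z - (n%:Z - 3 * j))%R|%N * qpoch q q `|(n%:Z - 3 * j)%R|%N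
   = p (n - 3 * `|j|%N)%N * p (n + 3 * `|j|%N)%N.
  have [j0|j0] : 0 <= j \/ j < 0 by lia.
    by rewrite mulrC; congr (p _ * p _); lia.
  by congr (p _ * p _); lia.
rewrite -(big_mkord (fun r => (3 * r <= n) && (`|j| <= r))%N
  (fun r => Q ^+ (r ^ 2 - `|j|%N ^ 2) * P (n - r - 1)%N
      / (p (n - 3 * r)%N * P (r - `|j|%N)%N * P (r + `|j|%N)%N))).
rewrite -(big_nat_widenl `|j|%N 0 _ (fun r => 3 * r <= n)%N) //.
rewrite -[X in \sum_(X <= _ < _ | _) _]add0n big_addn big_mkord.
have := cubic_sum F q hq (n.+1 - `|j|%N) (2 * `|j|%N) (n - 3 * `|j|%N) ltac:(lia) ltac:(lia).
rewrite (eq_bigl (fun s : 'I_(n.+1 - `|j|%N) => (3 * (s + `|j|%N) <= n)%N)); last by move=> s; lia.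
rewrite (eq_bigr (fun s : 'I_(n.+1 - `|j|%N) =>
  Q ^+ ((s + `|j|%N) ^ 2 - `|j|%N ^ 2) * P (n - (s + `|j|%N) - 1)%N
      / (p (n - 3 * (s + `|j|%N))%N * P (s + `|j|%N - `|j|%N)%N * P (s + `|j|%N + `|j|%N)%N))); last first.
  move=> s hs; congr (_ ^+ _ * P _ / (p _ * P _ * P _)); nia.
move=> ->; rewrite mulrA; congr (_ / (p _ * p _)); last by lia.
have -> : (2 * n = (2 * n - 1).+1)%N by lia.
by rewrite qpochS mulrC; congr (_ * p _); lia.
Qed.

(** With j = k - r the exponent 3j^2 + 3j + 3(r^2 - j^2) equals 3r^2 - 3r + 3k, linear in k, which
    leaves [gauss_sum] of base [Q] at [2 * r]. *)
Lemma signed_theta_sum r :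
  \sum_(k < (2 * r).+1) (-1) ^ (k%:Z - r%:Z) * q ^ (3 * (k%:Z - r%:Z) ^+ 2 + 3 * (k%:Z - r%:Z))
     * (Q ^+ (r ^ 2 - `|k%:Z - r%:Z|%N ^ 2)
      / (P (r - `|k%:Z - r%:Z|%N)%N * P (r + `|k%:Z - r%:Z|%N)%N))
  = (-1) ^+ r * q ^+ (3 * r ^ 2 - 3 * r) / qpoch (q ^+ 6) (q ^+ 6) r.
Proof.
have [E _] := gauss_sumE F Q (not_root_of_unityX F q 3 hq isT) r.
have -> : q ^+ 6 = Q ^+ 2 by rewrite /Q -exprM.
rewrite -E /gauss_sum mulr_sumr; apply: eq_bigr => k _.
have -> : P (r - `|k%:Z - r%:Z|%N)%N * P (r + `|k%:Z - r%:Z|%N)%N = P (2 * r - k)%N * P k.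
  have kr : (k <= 2 * r)%N by rewrite -ltnS.
  have [h|h] := leqP k r.
    by rewrite mulrC; congr (P _ * P _); lia.
  by congr (P _ * P _); lia.
have -> : (-1) ^ (k%:Z - r%:Z) = (-1) ^+ r * (-1) ^+ k :> F.
  by rewrite expfzDr ?oppr_eq0 ?oner_eq0 // mulrC -exprnP -exprnN -exprVn invrN1.
set x : int := k%:Z - r%:Z.
have xr : (`|x|%N <= r)%N by have := ltn_ord k; rewrite /x; lia.
(* x(x + 1) >= 0 for every integer x, so the exponent is natural and powers combine even at [q = 0].
   The witness serves both x = m and x = -(m + 1), which x -> -1 - x interchanges. *)
have [e [he hk]] : exists e : nat, 3 * x ^+ 2 + 3 * x = e%:Z /\
    (e + 3 * (r ^ 2 - `|x|%N ^ 2) = 3 * r ^ 2 - 3 * r + 3 * k)%N.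
  have [d rd] : exists d, r = (`|x| + d)%N by exists (r - `|x|)%N; lia.
  have r2 : (r <= r ^ 2)%N by rewrite -mulnn; nia.
  have dr : (r ^ 2 - `|x|%N ^ 2 = d ^ 2 + 2 * (d * `|x|))%N by rewrite rd -!mulnn; nia.
  have rr : (r ^ 2 = `|x| ^ 2 + d ^ 2 + 2 * (d * `|x|))%N by rewrite rd -!mulnn; nia.
  rewrite dr; have [m [xm|xm]] : exists m : nat, x = m%:Z \/ x = - m.+1%:Z.
    have [x0|x0] : 0 <= x \/ x < 0 by lia.
      by exists `|x|%N; left; lia.
    by exists (`|x|%N.-1); right; lia.
  - exists (3 * m ^ 2 + 3 * m)%N; split; first by rewrite xm -mulnn; nia.
    have am : `|x|%N = m by lia.
    have km : (k : nat) = (r + m)%N by rewrite /x in xm; lia.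
    by rewrite am in rr *; lia.
  - exists (3 * m ^ 2 + 3 * m)%N; split; first by rewrite xm -mulnn; nia.
    have am : `|x|%N = m.+1 by lia.
    have km : r = (k + m.+1)%N by rewrite /x in xm; lia.
    by rewrite am -(mulnn m.+1) in rr *; nia.
have -> : q ^ (3 * x ^+ 2 + 3 * x) = q ^+ e by rewrite he.
have hq2 : q ^+ e * Q ^+ (r ^ 2 - `|x|%N ^ 2) = q ^+ (3 * r ^ 2 - 3 * r) * Q ^+ k.
  by rewrite /Q -!exprM -!exprD hk.
rewrite [(- Q) ^+ k]exprNn.
set y := Q ^+ _ in hq2 *; set z := q ^+ e in hq2 *.
have -> : forall b c d f : F, b * c * z * (y / (d * f)) = b * c * (z * y) / d / f.
  by move=> *; rewrite invfM; ring.
by rewrite hq2; ring.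
Qed.
End Main.

Theorem theorem1p7 (F : fieldType) (q : F)
    (hq : forall k : nat, (0 < k)%N -> q ^+ k != 1)
    (n : nat) (hn : (0 < n)%N) :
  \sum_(j < n.+1 | (3 * j <= n)%N)
     ((-1) ^+ j * qpoch (q ^+ 3) (q ^+ 3) (n - j - 1) * (1 - q ^+ (2 * n))
        * q ^+ (3 * j ^ 2 - 3 * j)
      / (qpoch q q (n - 3 * j) * qpoch (q ^+ 6) (q ^+ 6) j))
  = \sum_(j \in [set: int]%classic)
     ((-1) ^ j * q ^ (3 * j ^+ 2 + 3 * j)
        * qbinom q (2 * n%:Z) (n%:Z - 3 * j)).
Proof.
(* [qbinom] is 0 unless 3|j| <= n, so the window from -n to n contains the support. *)
rewrite (fsbigE [seq (i : nat)%:Z - n%:Z | i <- index_iota 0 (2 * n).+1]); first last.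
- move=> j _ hj; rewrite /qbinom ifN ?mulr0 //; apply: contra hj => hj.
  apply/mapP; exists `|(j + n%:Z)%R|%N; last by lia.
  by rewrite mem_index_iota; lia.
- by [].
- by rewrite map_inj_uniq ?iota_uniq // => i i'; lia.
rewrite big_map (eq_bigl predT); last by move=> j; rewrite in_setT.
rewrite big_mkord.
under [RHS]eq_bigr => i _ do rewrite qbinom_cubic // mulrA mulr_sumr.
rewrite (exchange_big_dep (fun r : 'I_n.+1 => 3 * r <= n)%N) /=; last by move=> i r _ /andP[].
apply: eq_bigr => r hr.
pose G (j : int) := (-1) ^ j * q ^ (3 * j ^+ 2 + 3 * j) * ((q ^+ 3) ^+ (r ^ 2 - `|j|%N ^ 2)
      / (qpoch (q ^+ 3) (q ^+ 3) (r - `|j|%N)%N * qpoch (q ^+ 3) (q ^+ 3) (r + `|j|%N)%N)).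
transitivity ((1 - q ^+ (2 * n)) * qpoch (q ^+ 3) (q ^+ 3) (n - r - 1) / qpoch q q (n - 3 * r)
   * \sum_(k < (2 * r).+1) G (k%:Z - r%:Z)).
  rewrite /G signed_theta_sum // !invfM; ring.
rewrite -(@big_absz_le _ n) ?mulr_sumr; last by rewrite -ltnS.
apply: eq_big => [i|i _]; first by rewrite hr.
by rewrite /G !invfM; ring.
Qed.
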